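(* Let $q$ be a prime power, let $u$ be a positive integer, let $M=[m_{i\gamma}\mid 1\le i\le n,\ \gamma\in\mathbb{F}]$ be a doubly indexed list of nonnegative integers, and suppose $f\in I_M$ is nonzero. If a codeword $c=\mathrm{ev}(\mu)$ of the Hermitian code $C_u$, with $\mu\in\mathcal{L}(uP_\infty)$, satisfies $$\mathrm{score}_M(c)>\deg_u(f),$$ then $f(\mu)=0$ in $R$.
   Context: $\mathbb{F}$ is a finite field with $q^2$ elements. The Hermitian curve $H$ is the affine plane curve $Y^q+Y-X^{q+1}=0$ over $\mathbb{F}$, with coordinate ring $R=\mathbb{F}[X,Y]/\langle Y^q+Y-X^{q+1}\rangle=\mathbb{F}[x,y]$ (an integral domain). Every element of $R$ is uniquely an $\mathbb{F}$-linear combination of the monomials $x^iy^j$, $i\ge0$, $0\le j\le q-1$. $H$ has $n=q^3$ rational points $P_1,\dots,P_n$. The projective closure of $H$ is smooth with a unique point $P_\infty$ at infinity; $v_{P_\infty}$ is the corresponding valuation, with $v_{P_\infty}(x)=-q$ and $v_{P_\infty}(y)=-(q+1)$, so for nonzero $\varphi\in R$, $-v_{P_\infty}(\varphi)$ is the maximum of $qi+(q+1)j$ over the monomials $x^iy^j$ ($0\le j\le q-1$) occurring in $\varphi$; $-v_{P_\infty}(0)=-\infty$. $\mathcal{L}(uP_\infty)$ is the Riemann–Roch space of functions on $H$ with no poles except at $P_\infty$, of order at most $u$; it is the $\mathbb{F}$-span of the $x^iy^j$ with $i\ge 0$, $0\le j\le q-1$, $qi+(q+1)j\le u$. The evaluation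 map is $\mathrm{ev}:R\to\mathbb{F}^n$, $\varphi\mapsto(\varphi(P_1),\dots,\varphi(P_n))$, and $C_u=\mathrm{ev}(\mathcal{L}(uP_\infty))$. For a rational point $S=(P_i,\gamma)$, $\gamma\in\mathbb{F}$, of $H\times\mathbb{A}^1_{\mathbb{F}}$, let $\mathfrak{m}_S=\{f\in R[z]\mid f(S)=0\}$. For nonzero $f\in R[z]$, $\mathrm{mult}_S(f)$ is the largest integer $r$ with $f\in\mathfrak{m}_S^r$ (and $\mathrm{mult}_S(0)=\infty$). Define $I_M=\{f\in R[z]\mid \mathrm{mult}_{(P_i,\gamma)}(f)\ge m_{i\gamma}\text{ for all }1\le i\le n,\gamma\in\mathbb{F}\}=\bigcap_{i,\gamma}\mathfrak{m}_{(P_i,\gamma)}^{m_{i\gamma}}$. For $v=(v_1,\dots,v_n)\in\mathbb{F}^n$, $\mathrm{score}_M(v)=\sum_{i=1}^n m_{iv_i}$. For $f=\psi_az^a+\dots+\psi_1z+\psi_0\in R[z]$ with $\psi_i\in R$, $\deg_u(f)=\max_{0\le i\le a}(-v_{P_\infty}(\psi_i)+ui)$. For $\varphi\in R$, $f(\varphi)\in R$ denotes the result of substituting $\varphi$ for $z$ in $f$. *)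

(* Defs.v *)
From mathcomp Require Import all_boot all_order all_algebra.
From mathcomp Require Import qpoly.

Set Implicit Arguments.
Unset Strict Implicit.
Unset Printing Implicit Defensive.

Import GRing.Theory.
Local Open Scope ring_scope.

Section IdealPowers.
Variable A : comNzRingType.

(* f lies in the r-th power of the ideal I: f is a finite A-linear combination
   of products of r elements of I.  The coefficients matter for r = 0, where the
   power must be the whole ring. *)
Definition ideal_power (I : {pred A}) (r : nat) (f : A) : Prop :=
  exists s : seq (A * r.-tuple A),
    (forall t, t \in s -> {subset t.2 <= I}) /\
    f = \sum_(t <- s) t.1 * \prod_(g <- t.2) g.

End IdealPowers.

Section HermitianCurve.
Variables (F : finFieldType) (q : nat).

(* Y^q + Y - X^(q+1), a polynomial in Y with coefficients in F[X]. *)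
Definition herm_poly : {poly {poly F}} := 'X^q + 'X - ('X^(q.+1))%:P.

Lemma herm_polyE : (1 < q)%N -> mk_monic herm_poly = herm_poly :> {poly _}.
Proof.
move=> q1; have sz : (size ('X - ('X^(q.+1))%:P : {poly {poly F}})%R < q.+1)%N.
  by rewrite size_XsubC.
have s : size herm_poly = q.+1.
  by rewrite /herm_poly -addrA size_polyDl size_polyXn.
have m : herm_poly \is monic.
  by rewrite monicE /herm_poly -addrA lead_coefDl ?size_polyXn // lead_coefXn.
by rewrite /mk_monic s ltnS (ltnW q1) m.
Qed.

(* An element of the coordinate ring is stored as its canonical representative
   of degree < q in Y, so that for phi : herm_ring the coefficient of x^i y^j
   (0 <= j < q) is phi`_j`_i.  By herm_polyE the modulus is herm_poly. *)
Local Notation herm_ring := {poly %/ herm_poly}.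

Definition curve_point : predArgType :=
  {P : F * F | P.2 ^+ q + P.2 - P.1 ^+ q.+1 == 0}.

Definition eval_at (P : curve_point) (phi : herm_ring) : F :=
  (polyn phi).[(sval P).2%:P].[(sval P).1].

(* The order - v_(P_oo)(phi) of the pole of phi at infinity, for phi != 0,
   with v_(P_oo)(x) = - q and v_(P_oo)(y) = - (q + 1): the monomials x^i y^j with
   0 <= j < q have pairwise distinct valuations, so the pole order of phi is the
   largest q i + (q + 1) j over the monomials occurring in phi.  The value at
   phi = 0 is by convention 0 instead of -oo; deg_u skips zero coefficients. *)
Definition pole_order (phi : herm_ring) : nat :=
  \max_(j < q) \max_(i < size ((polyn phi)`_j)%R | ((polyn phi)`_j`_i != 0)%R)
    (q * i + q.+1 * j)%N.

Definition riemann_roch (u : nat) : {pred herm_ring} :=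
  [pred phi | (phi == 0) || (pole_order phi <= u)%N].

(* The maximum of - v_(P_oo)(psi_i) + u i over the coefficients psi_i of f, for
   f != 0: the indices with psi_i = 0, contributing -oo, are left out. *)
Definition deg_u (u : nat) (f : {poly herm_ring}) : nat :=
  \max_(i < size f | (f`_i != 0)%R) (pole_order (f`_i)%R + u * i)%N.

(* The ideal m_S of the rational point S = (P, gamma) of H x A^1. *)
Definition point_ideal (P : curve_point) (gamma : F) : {pred {poly herm_ring}} :=
  [pred f | (map_poly (eval_at P) f).[gamma] == 0].

(* mult_S(f) >= r; powers of an ideal decrease, so the largest exponent r' with
   f in m_S^r' is at least r exactly when f lies in m_S^r. *)
Definition mult_ge (P : curve_point) (gamma : F) (r : nat)
    (f : {poly herm_ring}) : Prop :=
  ideal_power (point_ideal P gamma) r f.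

Section Code.
Variable P : 'I_(q ^ 3) -> curve_point.

Definition ev (phi : herm_ring) : 'rV[F]_(q ^ 3) :=
  \row_i eval_at (P i) phi.

Definition hermitian_code (u : nat) (c : 'rV[F]_(q ^ 3)) : Prop :=
  exists2 phi : herm_ring, phi \in riemann_roch u & c = ev phi.

Definition I_M (m : 'I_(q ^ 3) -> F -> nat) (f : {poly herm_ring}) : Prop :=
  forall i gamma, mult_ge (P i) gamma (m i gamma) f.

Definition score (m : 'I_(q ^ 3) -> F -> nat) (c : 'rV[F]_(q ^ 3)) : nat :=
  (\sum_i m i (c ord0 i))%N.

End Code.
End HermitianCurve.

Notation herm_ring F q := {poly %/ herm_poly F q}.

(* Main.v *)
(* Suppose phi = f(mu) is nonzero.  Its norm N to F[x] is the product of the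
   conjugates phi(x, y + b), where b runs through the q elements of F with
   b^q + b = 0.  It is nonzero and its degree in x is at most the pole order of
   phi, hence at most deg_u f.  Above x = a, the coordinate y has at each rational
   point (a, b) an expansion in powers of x - a, and the expansions at two such
   points differ by a constant.  Since f lies in the m-th power of the ideal of
   (P_i, mu(P_i)), the expansion of phi at P_i is divisible by (x - a)^m; so N is
   divisible by (x - a)^e, where e is the sum of these exponents over the points
   above a.  Comparing degrees, score(c) <= deg_u f. *)

Require Import Defs.
From mathcomp Require Import all_boot all_order all_algebra all_field.
From mathcomp Require Import qpoly zify ring.

Set Implicit Arguments.
Unset Strict Implicit.
Unset Printing Implicit Defensive.

Import GRing.Theory.
Local Open Scope ring_scope.

(** * Weighted degree, with X of weight q and Y of weight q + 1, and reduction modulo [h] *)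

Section Weight.
Variables (F : finFieldType) (q : nat).

Local Notation h := (herm_poly F q).
Local Notation R2 := {poly {poly F}}.

(** Stated as a bound, so that 0 needs no convention, and for every polynomial in X and Y, so that
    products can be bounded before they are reduced modulo [h]. *)
Definition weight_le (n : nat) (p : R2) :=
  forall j i : nat, (n < q * i + q.+1 * j)%N -> p`_j`_i = 0.

Lemma weight_leW n n' p : (n <= n')%N -> weight_le n p -> weight_le n' p.
Proof. by move=> le_n wp j i lt_n; apply: wp; apply: leq_ltn_trans lt_n. Qed.

Lemma weight_le0 n : weight_le n 0.
Proof. by move=> j i _; rewrite !coef0. Qed.

Lemma weight_leD n p1 p2 :
  weight_le n p1 -> weight_le n p2 -> weight_le n (p1 + p2).
Proof. by move=> w1 w2 j i lt_n; rewrite !coefD w1 // w2 // addr0. Qed.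

Lemma weight_leN n p : weight_le n p -> weight_le n (- p).
Proof. by move=> w j i lt_n; rewrite !coefN w // oppr0. Qed.

Lemma weight_leM n1 n2 p1 p2 :
  weight_le n1 p1 -> weight_le n2 p2 -> weight_le (n1 + n2) (p1 * p2).
Proof.
move=> w1 w2 j i lt_n; rewrite coefM coef_sum big1 // => -[a /= le_a] _.
rewrite coefM big1 // => -[b /= le_b] _.
have [lt1|ge1] := ltnP n1 (q * b + q.+1 * a)%N; first by rewrite w1 // mul0r.
by rewrite w2 ?mulr0 //; nia.
Qed.

Lemma weight_le_sum (I : Type) (r : seq I) (P : pred I) (E : I -> R2) n :
  (forall i, P i -> weight_le n (E i)) -> weight_le n (\sum_(i <- r | P i) E i).
Proof.
by move=> w; elim/big_ind: _ => //; [exact: weight_le0 | exact: weight_leD].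
Qed.

Lemma weight_leC n (c : {poly F}) :
  (q * (size c).-1 <= n)%N -> weight_le n c%:P.
Proof.
move=> le_c [|j] i lt_n; rewrite coefC //= ?coef0 // nth_default //.
have {}lt_n : (q * (size c).-1 < q * i)%N by lia.
by move: lt_n; rewrite ltn_mul2l => /andP[_]; apply: leq_trans (leqSpred _).
Qed.

Lemma weight_le1 n : weight_le n 1.
Proof. by apply: weight_leC; rewrite size_poly1 muln0. Qed.

Lemma weight_leX : weight_le q.+1 'X.
Proof.
move=> j i lt_n; rewrite coefX; case: eqP => [j1|_]; last by rewrite coef0.
by rewrite coef1; case: eqP => // i0; lia.
Qed.

Lemma weight_leXn n p k : weight_le n p -> weight_le (n * k) (p ^+ k).
Proof.
move=> w; elim: k => [|k IHk]; first exact: weight_le1.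
by rewrite exprS mulnS; apply: weight_leM.
Qed.

Lemma weight_le_prod (I : finType) (P : pred I) (E : I -> R2) n :
  (forall i, P i -> weight_le n (E i)) ->
  weight_le (n * #|P|) (\prod_(i | P i) E i).
Proof.
move=> w; rewrite -sum1_card big_distrr /=.
elim/big_rec2: _ => [|i p k Pi IHp]; first exact: weight_le1.
by rewrite muln1; apply: weight_leM => //; apply: w.
Qed.

(* The specialization X -> T^q, Y -> T^(q+1): it multiplies, and it sends h to
   T^(q+1), of degree less than the weight q(q+1) of h. *)
Definition spec_inf (p : R2) : {poly F} :=
  (map_poly (comp_poly 'X^q) p).['X^(q.+1)].

Lemma spec_infM p1 p2 : spec_inf (p1 * p2) = spec_inf p1 * spec_inf p2.
Proof. by rewrite /spec_inf rmorphM hornerM. Qed.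

Lemma spec_infD p1 p2 : spec_inf (p1 + p2) = spec_inf p1 + spec_inf p2.
Proof. by rewrite /spec_inf rmorphD hornerD. Qed.

Lemma spec_infB p1 p2 : spec_inf (p1 - p2) = spec_inf p1 - spec_inf p2.
Proof. by rewrite /spec_inf rmorphB !hornerE. Qed.

Lemma spec_inf_herm : spec_inf h = 'X^(q.+1).
Proof.
rewrite /spec_inf /herm_poly !(rmorphB, rmorphD) /=.
rewrite map_polyX map_polyXn map_polyC /= !hornerE rmorphXn /= comp_polyX.
by rewrite -!exprM mulnC addrAC subrr add0r.
Qed.

Hypothesis q_gt1 : (1 < q)%N.

Lemma size_herm : size h = q.+1.
Proof.
by rewrite /herm_poly -addrA size_polyDl size_polyXn // size_XsubC.
Qed.

Lemma monic_herm : h \is monic.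
Proof. by rewrite -herm_polyE // monic_mk_monic. Qed.

Lemma weight_le_herm : weight_le (q * q.+1) h.
Proof.
apply: weight_leD; first apply: weight_leD.
- by rewrite mulnC; apply: weight_leXn weight_leX.
- by apply: weight_leW weight_leX; nia.
by apply/weight_leN/weight_leC; rewrite size_polyXn.
Qed.

Lemma coef_spec_inf m (p : R2) k : (size p <= m)%N ->
  (spec_inf p)`_k = \sum_(j < m) (if (k < q.+1 * j)%N then 0 else
    if (q %| k - q.+1 * j)%N then p`_j`_((k - q.+1 * j) %/ q) else 0).
Proof.
move=> sz; rewrite /spec_inf (@horner_coef_wide _ m); last first.
  exact: leq_trans (size_poly _ _) sz.
rewrite coef_sum; apply: eq_bigr => j _.
rewrite -exprM coefMXn coef_map /=.
by rewrite coef_comp_poly_Xn // (ltnW q_gt1).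
Qed.

Lemma size_spec_inf n p : weight_le n p -> (size (spec_inf p) <= n.+1)%N.
Proof.
move=> w; apply/leq_sizeP => k lt_nk.
rewrite (coef_spec_inf _ (leqnn _)) big1 // => j _.
case: ltnP => // le_k; case: ifP => // /dvdnP[i ei].
rewrite ei mulnK ?(ltnW q_gt1) // w //.
by rewrite -(subnK le_k) ei in lt_nk; rewrite mulnC; exact: lt_nk.
Qed.

(** The weights q i + (q + 1) j with j < q are pairwise distinct, so no two monomials of a reduced
    polynomial meet under the specialization. *)
Lemma coef_spec_inf_reduced (p : R2) i j : (size p <= q)%N -> (j < q)%N ->
  (spec_inf p)`_(q * i + q.+1 * j) = p`_j`_i.
Proof.
move=> sz lt_jq; rewrite (coef_spec_inf _ sz) (bigD1 (Ordinal lt_jq)) //=.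
rewrite ltnNge leq_addl /= addnK dvdn_mulr // mulKn ?(ltnW q_gt1) //.
rewrite big1 ?addr0 // => -[a lt_aq]; rewrite -val_eqE /= => ne_aj.
case: ltnP => // le_a; case: ifP => // /dvdnP[b eb]; case/eqP: ne_aj.
have e : (q * i + q.+1 * j = b * q + q.+1 * a)%N by rewrite -eb subnK.
(* Reduction modulo q recovers the exponent of Y. *)
have : ((i + j) * q + j = (b + a) * q + a)%N by nia.
by move/(congr1 (modn^~ q)); rewrite /= !modnMDl !modn_small.
Qed.

(* The part of weight n of p does not vanish under the specialization. *)
Definition has_weight n p := weight_le n p /\ size (spec_inf p) = n.+1.

Lemma has_weight_neq0 n p : has_weight n p -> p != 0.
Proof.
case=> _ sz; apply: contra_eq_neq sz => ->.
by rewrite /spec_inf rmorph0 horner0 size_poly0.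
Qed.

(** The specializations multiply in the domain F[T], so their degrees add: pole orders are
    additive. *)
Lemma has_weightM n1 n2 p1 p2 :
  has_weight n1 p1 -> has_weight n2 p2 -> has_weight (n1 + n2) (p1 * p2).
Proof.
case=> w1 s1 [w2 s2]; split; first exact: weight_leM.
by rewrite spec_infM size_mul -?size_poly_gt0 ?s1 ?s2 // addnS.
Qed.

Lemma reduced_has_weight (p : R2) :
  p != 0 -> (size p <= q)%N -> exists n, has_weight n p.
Proof.
move=> nz sz; exists (size (spec_inf p)).-1.
have nz_spec j i : p`_j`_i != 0 -> (q * i + q.+1 * j < size (spec_inf p))%N.
  move=> nzc; have lt_jq : (j < q)%N.
    apply: leq_trans sz; rewrite ltnNge; apply: contra nzc => le_j.
    by rewrite (nth_default _ le_j) coef0.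
  rewrite ltnNge; apply: contra nzc => le_s.
  by rewrite -coef_spec_inf_reduced // nth_default.
split; last first.
  rewrite prednK //.
  apply: leq_ltn_trans (nz_spec (size p).-1 (size (lead_coef p)).-1 _) => //.
  by rewrite -/(lead_coef p) -/(lead_coef (lead_coef p)) !lead_coef_eq0.
move=> j i lt_n; apply/eqP; apply: contraLR lt_n => /nz_spec; lia.
Qed.

(** Division by [h], one leading term at a time. Each subtracted multiple [e * h] keeps the bound n,
    since [h] has weight q (q + 1); its specialization has degree below n, since that of [h] has
    degree only q + 1. The coefficient of T^n is thus never altered. *)
Lemma weight_rdiv_herm n p : weight_le n p -> exists k,
  [/\ (size (p - k * h)%R <= q)%N, weight_le n (p - k * h)
    & (size (spec_inf (k * h)%R) <= n)%N].
Proof.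
have [s] := ubnP (size p); elim: s => // s IHs in p *; rewrite ltnS => le_ps w.
have [le_pq|lt_qp] := leqP (size p) q.
  exists 0; rewrite mul0r subr0; split=> //.
  by rewrite /spec_inf rmorph0 horner0 size_poly0.
have nz_p : p != 0 by rewrite -size_poly_gt0; lia.
set d := (size p).-1; have le_qd : (q <= d)%N by rewrite /d; lia.
have le_n : (q.+1 * d <= n)%N.
  rewrite leqNgt; apply/negP => lt_n.
  have : lead_coef (lead_coef p) != 0 by rewrite !lead_coef_eq0.
  by case/eqP; apply: w; apply: leq_trans lt_n (leq_addl _ _).
pose e : R2 := (lead_coef p)%:P * 'X^(d - q).
have we : weight_le (n - q * q.+1) e.
  move=> j i lt_n; rewrite coefCM coefXn.
  case: eqP => [ej|]; last by rewrite mulr0 coef0.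
  by rewrite mulr1 /lead_coef w // -/d; nia.
have weh : weight_le n (e * h).
  rewrite -(subnK (_ : q * q.+1 <= n)%N); last by nia.
  exact: weight_leM we weight_le_herm.
have sz_eh : size (e * h) = size p.
  rewrite size_Mmonic ?monic_herm //; last first.
    by rewrite mulf_neq0 ?polyC_eq0 ?lead_coef_eq0 // -size_poly_gt0 size_polyXn.
  rewrite size_herm size_Cmul ?lead_coef_eq0 // size_polyXn /d; lia.
have lc_eh : lead_coef (e * h) = lead_coef p.
  rewrite lead_coef_Mmonic ?monic_herm // lead_coefM lead_coefC lead_coefXn.
  by rewrite mulr1.
have [||k [sz_k w_k s_k]] := IHs (p - e * h).
- apply: leq_trans le_ps; rewrite -[X in (_ < X)%N](ltn_predK lt_qp) ltnS.
  apply/leq_sizeP => j; rewrite leq_eqVlt => /orP[/eqP<-|lt_j].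
    by rewrite coefB -{2}sz_eh -/(lead_coef p) -/(lead_coef (e * h)) lc_eh subrr.
  have le_j : (size p <= j)%N by rewrite -(ltn_predK lt_qp).
  by rewrite coefB !nth_default ?subrr // sz_eh.
- exact: weight_leD (weight_leN weh).
exists (e + k); rewrite mulrDl opprD addrA; split=> //.
rewrite spec_infD (leq_trans (size_polyD _ _)) // geq_max s_k andbT.
rewrite spec_infM spec_inf_herm (leq_trans (size_polyMleq _ _)) // size_polyXn.
by have := size_spec_inf we; nia.
Qed.

Lemma rmodp_herm p k :
  (size (p - k * h)%R <= q)%N -> Pdiv.Ring.rmodp p h = p - k * h.
Proof.
move=> sz; rewrite -{1}[p](subrK (k * h)) addrC.
by rewrite Pdiv.RingMonic.rmodp_addl_mul_small ?monic_herm // size_herm ltnS.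
Qed.

Lemma weight_le_rmodp n p : weight_le n p -> weight_le n (Pdiv.Ring.rmodp p h).
Proof. by case/weight_rdiv_herm=> k [sz w _]; rewrite (rmodp_herm sz). Qed.

(** This shows that the remainder of a norm modulo [h] is nonzero. *)
Lemma has_weight_rmodp n p :
  has_weight n p -> has_weight n (Pdiv.Ring.rmodp p h).
Proof.
case=> w s; split; first exact: weight_le_rmodp.
have [k [sz _ s_k]] := weight_rdiv_herm w.
by rewrite (rmodp_herm sz) spec_infB size_polyDl ?size_polyN s.
Qed.

End Weight.

(** * The translations y -> y + b of the curve, and norms to F[x] *)

Section Conjugates.
Variables (F : finFieldType) (q : nat).
Hypotheses (q_gt1 : (1 < q)%N) (q_pchar : [pchar F].-nat q).

Local Notation h := (herm_poly F q).
Local Notation R2 := {poly {poly F}}.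

(** When F has q^2 elements, this is the kernel of the trace to the subfield with q elements. *)
Definition trace_kernel : {set F} := [set b | b ^+ q + b == 0].

Local Notation shift b p := (p \Po ('X + b%:P%:P)).

Lemma horner_herm (y : {poly F}) : h.[y] = y ^+ q + y - 'X^(q.+1).
Proof. by rewrite /herm_poly !hornerE. Qed.

Lemma pchar_polyE n : [pchar {poly F}].-nat n = [pchar F].-nat n.
Proof. exact/eq_pnat/pchar_poly. Qed.

Lemma pchar_poly2E n : [pchar R2].-nat n = [pchar F].-nat n.
Proof. by rewrite -pchar_polyE; exact/eq_pnat/pchar_poly. Qed.

Lemma trace_kernelD b b' : b' \in trace_kernel ->
  (b' + b \in trace_kernel) = (b \in trace_kernel).
Proof.
by rewrite !inE => /eqP b'0; rewrite exprDn_pchar // addrACA b'0 add0r.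
Qed.

Lemma trace_kernelB b b' :
  b ^+ q + b = b' ^+ q + b' -> b - b' \in trace_kernel.
Proof.
move=> bb'; rewrite inE exprDn_pchar // exprNn_pchar // addrACA -opprD.
by rewrite bb' subrr.
Qed.

Lemma curve_pointE (P : curve_point F q) :
  (sval P).2 ^+ q + (sval P).2 = (sval P).1 ^+ q.+1.
Proof. by apply/eqP; rewrite -subr_eq0; apply: (valP P). Qed.

Lemma shift_herm b : b \in trace_kernel -> shift b h = h.
Proof.
rewrite inE => /eqP b0.
rewrite /herm_poly comp_polyB comp_polyD comp_polyX comp_polyC rmorphXn /=.
rewrite comp_polyX exprDn_pchar ?pchar_poly2E // addrACA -!polyC_exp -!polyCD b0.
by rewrite addr0.
Qed.

Lemma size_shift b (p : R2) : size (shift b p) = size p.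
Proof. by rewrite size_comp_poly2 // size_XaddC. Qed.

Lemma shift_eq0 b (p : R2) : (shift b p == 0) = (p == 0).
Proof. by rewrite -!size_poly_eq0 size_shift. Qed.

Lemma weight_le_comp n (p p' : R2) :
  weight_le q n p -> weight_le q q.+1 p' -> weight_le q n (p \Po p').
Proof.
move=> w w'; rewrite comp_polyE; apply: weight_le_sum => j _.
rewrite -mul_polyC; have [->|nz] := eqVneq p`_j 0.
  by rewrite mul0r; apply: weight_le0.
have le_jn : (q.+1 * j <= n)%N.
  rewrite leqNgt; apply/negP => lt_n; move: (nz).
  rewrite -lead_coef_eq0; case/eqP; apply: w.
  exact: leq_trans lt_n (leq_addl _ _).
rewrite -(subnK le_jn); apply: weight_leM; last exact: weight_leXn.
move=> [|k] i lt_n; rewrite coefC //= ?coef0 // w //.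
by rewrite -(subnK le_jn) ltn_add2r; lia.
Qed.

Lemma weight_le_shift n b (p : R2) :
  weight_le q n p -> weight_le q n (shift b p).
Proof.
move=> w; apply: weight_le_comp => //; apply: weight_leD; first exact: weight_leX.
by apply: weight_leC; rewrite size_polyC; case: eqP; rewrite muln0.
Qed.

Lemma card_trace_kernel_le : (#|trace_kernel| <= q)%N.
Proof.
pose g : {poly F} := 'X^q + 'X.
have sg : size g = q.+1 by rewrite size_polyDl size_polyXn // size_polyX ltnS.
rewrite cardE -ltnS -sg; apply: max_poly_roots; rewrite ?enum_uniq //.
  by rewrite -size_poly_gt0 sg.
by apply/allP => b; rewrite mem_enum inE rootE !hornerE.
Qed.

(** Invariance gives p(b) = p(0) for each b in the kernel, so p - p(0) has at least q roots but
    degree below q in Y. *)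
Lemma shift_invariant (p : R2) : (q <= #|trace_kernel|)%N -> (size p <= q)%N ->
  {in trace_kernel, forall b, shift b p = p} -> p = (p.[0])%:P.
Proof.
move=> card_B sz inv; apply/eqP; rewrite -subr_eq0; apply/eqP.
apply: (@roots_geq_poly_eq0 _ _ [seq b%:P | b <- enum trace_kernel]).
- apply/allP => _ /mapP[b Bb ->]; rewrite mem_enum in Bb.
  have := congr1 (horner^~ 0) (inv b Bb).
  rewrite horner_comp hornerD hornerX hornerC add0r => pb.
  by rewrite rootE hornerD hornerN hornerC pb subrr.
- by rewrite map_inj_uniq ?enum_uniq //; apply: polyC_inj.
rewrite size_map -cardE (leq_trans _ card_B) //.
rewrite (leq_trans (size_polyD _ _)) // geq_max sz size_polyN size_polyC.
by case: eqP => // _; rewrite ltnW.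
Qed.

(* The norm of a nonzero p from the function field of the curve to F(x). *)
Lemma norm_exists n (p : R2) : #|trace_kernel| = q ->
  p != 0 -> (size p <= q)%N -> weight_le q n p ->
  exists (c : {poly F}) (k : R2), [/\ c != 0, (size c <= n.+1)%N
    & \prod_(b in trace_kernel) shift b p = k * h + c%:P].
Proof.
move=> card_B nz_p sz_p w_p; set N := \prod_(b in _) _.
(* The value of [n'] is irrelevant: this only serves to show that the remainder is nonzero. The
   degree bound comes from [wN']. *)
have [n' wN] : exists n', has_weight q n' N.
  apply: (big_ind (fun P => exists n', has_weight q n' P))
    => [|P1 P2 [n1 w1] [n2 w2]|b _].
  - apply: reduced_has_weight => //; first exact: oner_neq0.
    by rewrite size_poly1 ltnW.
  - by exists (n1 + n2)%N; apply: has_weightM.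
  - by apply: reduced_has_weight => //; rewrite ?shift_eq0 ?size_shift.
have wN' : weight_le q (n * #|trace_kernel|) N.
  by apply: weight_le_prod => b _; apply: weight_le_shift.
rewrite card_B in wN'.
have mon := monic_herm F q_gt1.
set r := Pdiv.Ring.rmodp N h.
have sz_r : (size r <= q)%N.
  by rewrite -ltnS -(size_herm F q_gt1) Pdiv.Ring.ltn_rmodp monic_neq0.
have NE : N = Pdiv.Ring.rdivp N h * h + r by apply: Pdiv.RingMonic.rdivp_eq.
(* A translation by b permutes the factors of the norm. *)
have inv_N b : b \in trace_kernel -> shift b N = N.
  move=> Bb; rewrite rmorph_prod /= /N [RHS](reindex_inj (addrI b)) /=.
  apply: eq_big => [b'|b' _]; first by rewrite trace_kernelD.
  by rewrite -comp_polyA comp_polyD comp_polyX comp_polyC -addrA -!polyCD.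
have inv_r : {in trace_kernel, forall b, shift b r = r}.
  move=> b Bb; have := inv_N b Bb.
  rewrite {1}NE comp_polyD comp_polyM shift_herm //.
  move/(congr1 (fun P : R2 => Pdiv.Ring.rmodp P h)).
  by rewrite Pdiv.RingMonic.rmodp_addl_mul_small // size_shift size_herm // ltnS.
have rE : r = (r.[0])%:P by apply: shift_invariant => //; rewrite card_B.
exists r.[0], (Pdiv.Ring.rdivp N h); split; last by rewrite -rE.
  by rewrite -polyC_eq0 -rE; apply: has_weight_neq0 (has_weight_rmodp _ wN).
rewrite leqNgt; apply/negP => lt_n.
have r0 : r`_0 = r.[0] by rewrite {1}rE coefC.
(* The q conjugates give the norm weight at most n q, and X has weight q; hence the degree in X is
   at most n. *)
have lt_w : (n * q < q * (size r.[0]).-1 + q.+1 * 0)%N.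
  by rewrite muln0 addn0 mulnC ltn_pmul2l ?(ltnW q_gt1) // -ltnS (ltn_predK lt_n).
have /eqP := weight_le_rmodp q_gt1 wN' lt_w.
rewrite -/r r0 -/(lead_coef _) lead_coef_eq0 => /eqP e.
by rewrite e size_poly0 in lt_n.
Qed.

(** Each point is determined by its abscissa and the difference, in the kernel, between its ordinate
    and that of a chosen point with the same abscissa. With q^3 points this bounds the kernel from
    below. *)
Lemma card_trace_kernel (n : nat) (P : 'I_n -> curve_point F q) :
  injective P -> (n <= #|F| * #|trace_kernel|)%N.
Proof.
move=> injP; pose x i := (sval (P i)).1; pose y i := (sval (P i)).2.
(* The default is never reached, since i itself qualifies; so [rep i] depends on [x i] alone. *)
pose rep i := odflt i [pick j | x j == x i].
have x_rep i : x (rep i) = x i.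
  by rewrite /rep; case: pickP => [j /eqP //|/(_ i)]; rewrite eqxx.
pose g i := (x i, y i - y (rep i)).
have inj_g : injective g.
  move=> i j [xij yij]; apply/injP/val_inj.
  have rij : rep i = rep j.
    by rewrite /rep xij; case: pickP => [//|/(_ j)]; rewrite eqxx.
  move: yij; rewrite rij => /addIr yij.
  by rewrite [LHS]surjective_pairing [RHS]surjective_pairing; congr (_, _).
rewrite -[n in (n <= _)%N]card_ord -cardsT -(card_imset _ inj_g).
rewrite -[#|F|]cardsT -cardsX.
apply/subset_leq_card/subsetP => _ /imsetP[i _ ->];
rewrite inE in_setT /=; apply: trace_kernelB.
by rewrite !curve_pointE -/(x i) -x_rep.
Qed.

End Conjugates.

(** * Local expansions at rational points, multiplicities and pole orders *)

Section LocalParameter.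
Variables (F : finFieldType) (q : nat).
Hypotheses (q_gt1 : (1 < q)%N) (q_pchar : [pchar F].-nat q).

Local Notation h := (herm_poly F q).
Local Notation R := (herm_ring F q).

(* Newton's iteration y -> y - h(y), for dh/dY = 1: it turns the error e into
   - e^q. *)
Lemma local_expansion a b (K : nat) : b ^+ q + b = a ^+ q.+1 ->
  exists2 y : {poly F}, y.[a] = b & ('X - a%:P) ^+ K %| h.[y].
Proof.
(* The exponent [K.+1] is positive, so h(y) vanishes at a and a Newton step preserves the value of y
   there. *)
move=> hab; suff [y ya dvd_y] : exists2 y : {poly F},
    y.[a] = b & ('X - a%:P) ^+ K.+1 %| h.[y].
  by exists y => //; apply: dvdp_trans dvd_y; rewrite dvdp_exp2l.
elim: K => [|K [y ya dvd_y]].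
  exists b%:P; first by rewrite hornerC.
  by rewrite expr1 dvdp_XsubCl rootE horner_herm !hornerE hab subrr.
exists (y - h.[y]).
  have : root h.[y] a by rewrite -dvdp_XsubCl (dvdp_trans _ dvd_y) // dvdp_exp.
  by rewrite rootE hornerD hornerN ya => /eqP->; rewrite subr0.
have -> : h.[y - h.[y]] = - h.[y] ^+ q.
  rewrite [LHS]horner_herm exprDn_pchar ?pchar_polyE //.
  rewrite exprNn_pchar ?pchar_polyE //.
  have -> : y - h.[y] = 'X^(q.+1) - y ^+ q by rewrite horner_herm; ring.
  by ring.
(* The precision grows because (K + 1) q >= K + 2 for q >= 2. *)
rewrite dvdpNr (dvdp_trans _ (dvdp_exp2r q dvd_y)) // -exprM dvdp_exp2l //.
nia.
Qed.

Definition expand (y : {poly F}) (phi : R) : {poly F} := (polyn phi).[y].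

Lemma polynM (phi psi : R) :
  polyn (phi * psi) = Pdiv.Ring.rmodp (polyn phi * polyn psi) h.
Proof. by rewrite poly_of_qpolyM; move: (_ * _) => P; rewrite herm_polyE. Qed.

(** The representative of a product is a remainder modulo [h]. As y is only an approximate root of
    [h], [expand y] is multiplicative only modulo [h.[y]]. *)
Lemma expandM y (phi psi : R) :
  h.[y] %| expand y phi * expand y psi - expand y (phi * psi).
Proof.
rewrite /expand polynM -hornerM.
move: (polyn phi * polyn psi) => P.
have -> : P.[y] = (Pdiv.Ring.rdivp P h).[y] * h.[y] + (Pdiv.Ring.rmodp P h).[y].
  by rewrite {1}(Pdiv.RingMonic.rdivp_eq (monic_herm F q_gt1) P) hornerD hornerM.
by rewrite addrK dvdp_mull.
Qed.

Lemma expand_sum y (I : Type) (r : seq I) (E : I -> R) :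
  expand y (\sum_(i <- r) E i) = \sum_(i <- r) expand y (E i).
Proof. by rewrite /expand poly_of_qpoly_sum horner_sum. Qed.

Lemma horner_horner_herm (P : curve_point F q) :
  h.[(sval P).2%:P].[(sval P).1] = 0.
Proof. by rewrite horner_herm !hornerE curve_pointE subrr. Qed.

Lemma eval_at_sum P (I : Type) (r : seq I) (E : I -> R) :
  eval_at P (\sum_(i <- r) E i) = \sum_(i <- r) eval_at P (E i).
Proof. by rewrite /eval_at poly_of_qpoly_sum !horner_sum. Qed.

Lemma eval_atM P (phi psi : R) :
  eval_at P (phi * psi) = eval_at P phi * eval_at P psi.
Proof.
have /dvdpP[k] := expandM (sval P).2%:P phi psi.
move/(congr1 (horner^~ (sval P).1)); rewrite hornerM horner_horner_herm mulr0.
by move/eqP; rewrite hornerD hornerN hornerM subr_eq0 => /eqP.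
Qed.

Lemma eval_atX P (phi : R) n : eval_at P (phi ^+ n) = eval_at P phi ^+ n.
Proof.
elim: n => [|n IHn]; last by rewrite !exprS eval_atM IHn.
by rewrite /eval_at /= !hornerE.
Qed.

Lemma eval_at_horner P (g : {poly R}) (mu : R) :
  eval_at P g.[mu] = (map_poly (eval_at P) g).[eval_at P mu].
Proof.
rewrite horner_coef eval_at_sum (horner_coef_wide _ (size_poly _ _)).
apply: eq_bigr => i _; rewrite eval_atM eval_atX coef_map_id0 //.
by rewrite /eval_at !horner0.
Qed.

(** After z := mu, each element of the point ideal vanishes at P, so its expansion is divisible by X
    - a. In a product of r of them these factors accumulate, and the errors of [expandM] are
    absorbed by the divisibility of [h.[y]]. *)
Lemma mult_ge_expand P (mu : R) (f : {poly R}) (r : nat) (y : {poly F}) :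
  mult_ge P (eval_at P mu) r f -> y.[(sval P).1] = (sval P).2 ->
  ('X - (sval P).1%:P) ^+ r %| h.[y] ->
  ('X - (sval P).1%:P) ^+ r %| expand y f.[mu].
Proof.
set a := (sval P).1; move=> [s [s_in ->]] ya dvd_h.
rewrite horner_sum expand_sum big_seq_cond.
elim/big_ind: _ => [||t /andP[t_s _]]; first exact: dvdp0.
  by move=> *; apply: dvdp_add.
have expandM_dvd k phi psi : (k <= r)%N ->
  ('X - a%:P) ^+ k %| expand y phi * expand y psi ->
  ('X - a%:P) ^+ k %| expand y (phi * psi).
  move=> le_k dvd_k; rewrite -(dvdp_subr _ dvd_k).
  apply: dvdp_trans (expandM _ _ _); apply: dvdp_trans dvd_h.
  exact: dvdp_exp2l.
rewrite hornerM horner_prod; apply/expandM_dvd/dvdp_mull => //.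
suff dvd_l (l : seq {poly R}) : (size l <= r)%N ->
    {subset l <= point_ideal P (eval_at P mu)} ->
    ('X - a%:P) ^+ size l %| expand y (\prod_(g <- l) g.[mu]).
  by have := dvd_l t.2; rewrite size_tuple; apply=> //; apply: s_in.
elim: l => [|g l IHl] /= le_l l_in; first by rewrite expr0 dvd1p.
rewrite big_cons; apply: expandM_dvd => //; rewrite exprS.
apply: dvdp_mul; last first.
  by apply: IHl => [|g' g'_l]; [exact: ltnW | apply: l_in; rewrite inE g'_l orbT].
have /eqP := l_in g (mem_head _ _).
rewrite -eval_at_horner /eval_at -/a => g0.
rewrite dvdp_XsubCl rootE /expand.
(* At X = a the expansion y may be replaced by its constant term, the ordinate of P. *)
suff -> : (polyn g.[mu]).[y].[a] = (polyn g.[mu]).[(sval P).2%:P].[a] by rewrite g0.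
rewrite [_.[y]]horner_coef [_.[_%:P]]horner_coef !horner_sum.
apply: eq_bigr => i _.
by rewrite !hornerM !horner_exp hornerC ya.
Qed.

Lemma prod_XsubC_exp_dvdp (s : seq F) (e : F -> nat) (c : {poly F}) : uniq s ->
  (forall a, a \in s -> ('X - a%:P) ^+ e a %| c) ->
  \prod_(a <- s) ('X - a%:P) ^+ e a %| c.
Proof.
elim: s => [|a s IHs] /=; first by rewrite big_nil dvd1p.
case/andP=> a_s uniq_s dvd_c; rewrite big_cons Gauss_dvdp.
  rewrite dvd_c ?mem_head // IHs // => b b_s.
  by apply: dvd_c; rewrite inE b_s orbT.
apply: coprimep_expl; rewrite coprimep_sym coprimep_XsubC rootE horner_prod.
rewrite prodf_seq_neq0; apply/allP => b b_s /=.
rewrite horner_exp hornerXsubC expf_neq0 // subr_eq0.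
by apply: contraNneq a_s => ->.
Qed.

Lemma size_prod_XsubC_exp (s : seq F) (e : F -> nat) :
  size (\prod_(a <- s) ('X - a%:P) ^+ e a) = (\sum_(a <- s) e a).+1.
Proof.
elim: s => [|a s IHs]; first by rewrite !big_nil size_poly1.
have mon : \prod_(b <- s) ('X - b%:P) ^+ e b \is monic.
  by apply: monic_prod => b _; rewrite monic_exp ?monicXsubC.
rewrite !big_cons size_Mmonic // ?IHs ?size_exp_XsubC ?addnS //.
by rewrite monic_neq0 // monic_exp ?monicXsubC.
Qed.

Lemma weight_le_pole_order (phi : R) : weight_le q (pole_order phi) (polyn phi).
Proof.
move=> j i lt_n; apply/eqP; apply: contraLR lt_n => nz; rewrite -leqNgt.
have lt_jq : (j < q)%N.
  have sz : (size (polyn phi) <= q)%N.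
    by rewrite -ltnS -(size_herm F q_gt1) -{2}(herm_polyE _ q_gt1) size_mk_monic.
  apply: leq_trans sz; rewrite ltnNge; apply: contra nz => le_j.
  by rewrite (nth_default _ le_j) coef0.
have lt_i : (i < size ((polyn phi)`_j)%R)%N.
  by rewrite ltnNge; apply: contra nz => le_i; rewrite nth_default.
rewrite /pole_order (leq_trans _ (leq_bigmax (Ordinal lt_jq))) //=.
exact: (leq_bigmax_cond (Ordinal lt_i)).
Qed.

Lemma weight_le_herm_ringM n1 n2 (phi psi : R) :
  weight_le q n1 (polyn phi) -> weight_le q n2 (polyn psi) ->
  weight_le q (n1 + n2) (polyn (phi * psi)).
Proof. by move=> w1 w2; rewrite polynM; apply/weight_le_rmodp/weight_leM. Qed.

(** Each term psi_i mu^i has weight at most that of psi_i plus u i; the zero coefficients skipped by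
    [deg_u] contribute nothing. *)
Lemma weight_le_deg_u u (mu : R) (f : {poly R}) : mu \in riemann_roch u ->
  weight_le q (deg_u u f) (polyn f.[mu]).
Proof.
move=> mu_in; have w_mu : weight_le q u (polyn mu).
  case/orP: mu_in => [/eqP->|le_u]; first exact: weight_le0.
  by apply: weight_leW le_u _; apply: weight_le_pole_order.
have w_muX k : weight_le q (u * k) (polyn (mu ^+ k)).
  elim: k => [|k IHk]; first exact: weight_le1.
  by rewrite exprS mulnS; apply: weight_le_herm_ringM.
rewrite horner_coef poly_of_qpoly_sum; apply: weight_le_sum => i _.
have [->|nz] := eqVneq f`_i 0; first by rewrite mul0r; apply: weight_le0.
apply: weight_leW (leq_bigmax_cond i nz) _.
by apply: weight_le_herm_ringM (w_muX i); apply: weight_le_pole_order.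
Qed.

End LocalParameter.

(** * Comparison of the degree of the norm with the score *)

Theorem proposition3 (q : nat)
    (q_pp : exists p k : nat, [/\ prime p, (0 < k)%N & q = (p ^ k)%N])
    (F : finFieldType) (cardF : #|F| = (q ^ 2)%N)
    (* the rational points P_1, ..., P_n of the curve, n = q^3 *)
    (P : 'I_(q ^ 3) -> curve_point F q) (P_bij : bijective P)
    (u : nat) (u_gt0 : (0 < u)%N)
    (m : 'I_(q ^ 3) -> F -> nat)
    (f : {poly herm_ring F q}) (f_in : I_M P m f) (f_neq0 : f != 0)
    (c : 'rV[F]_(q ^ 3)) (c_in : hermitian_code P u c)
    (mu : herm_ring F q) (mu_in : mu \in riemann_roch u) (c_ev : c = ev P mu)
    (hscore : (deg_u u f < score m c)%N) :
  f.[mu] = 0.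
Proof.
have [p [k [p_pr k_gt0 qE]]] := q_pp.
have q_gt1 : (1 < q)%N.
  by rewrite qE (leq_trans (prime_gt1 p_pr)) // -{1}(expn1 p) leq_exp2l ?prime_gt1.
have q_pchar : [pchar F].-nat q.
  have pF : p \in [pchar F].
    by apply: (@card_finPcharP F p (k * 2)) => //; rewrite cardF qE expnM.
  by rewrite (eq_pnat _ (pcharf_eq pF)) qE pnatX pnat_id.
have injP : injective P by apply: bij_inj.
(* At most q as roots of Y^q + Y; at least q because q^3 points lie over q^2 abscissas. *)
have card_B : #|trace_kernel F q| = q.
  apply/eqP; rewrite eqn_leq card_trace_kernel_le //=.
  have := card_trace_kernel q_pchar injP.
  by rewrite cardF (expnS q 2) mulnC leq_pmul2l // expn_gt0 ltnW.
apply/eqP/negP => /negP nz; set phi := f.[mu] in nz.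
have nz_p : polyn phi != 0 by apply: contra nz => /eqP p0; apply/eqP/val_inj.
have sz_p : (size (polyn phi) <= q)%N.
  by rewrite -ltnS -(size_herm F q_gt1) -{2}(herm_polyE _ q_gt1) size_mk_monic.
have [d [l [nz_d sz_d normE]]] :=
  norm_exists q_gt1 q_pchar card_B nz_p sz_p (weight_le_deg_u q_gt1 mu_in).
pose x i := (sval (P i)).1; pose y i := (sval (P i)).2.
pose e i := m i (eval_at (P i) mu).
pose E a := (\sum_(i | x i == a) e i)%N.
(* The exponents [E a] add up to the score, which exceeds the degree of the nonzero [d]. *)
suff dvd_d a : ('X - a%:P) ^+ E a %| d.
  have := prod_XsubC_exp_dvdp (index_enum_uniq F) (fun a _ => dvd_d a).
  move/(dvdp_leq nz_d).
  rewrite size_prod_XsubC_exp leqNgt ltnS => /negP; apply.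
  apply: leq_trans sz_d (leq_trans hscore _).
  rewrite /score c_ev (partition_big x xpredT) //=; apply: leq_sum => a _.
  by apply: leq_sum => i _; rewrite mxE.
have [i0 xi0|no_pt] := pickP (fun i => x i == a); last first.
  by rewrite /E big_pred0 // expr0 dvd1p.
(* One expansion, at [P i0], serves all points above a after adding the constants [g i]; precision
   [E a] is enough since each [e i] is at most [E a]. *)
have [Y Ya dvd_Y] := local_expansion q_gt1 q_pchar (E a) (curve_pointE (P i0)).
rewrite -/(x i0) (eqP xi0) in Ya dvd_Y.
have dE : \prod_(b in trace_kernel F q) (polyn phi).[Y + b%:P]
    = l.[Y] * (herm_poly F q).[Y] + d.
  have := congr1 (horner^~ Y) normE; rewrite hornerD hornerM hornerC => <-.
  rewrite horner_prod; apply: eq_bigr => b _.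
  by rewrite horner_comp hornerD hornerX hornerC.
suff : ('X - a%:P) ^+ E a %| l.[Y] * (herm_poly F q).[Y] + d.
  by rewrite dvdp_addr // dvdp_mull.
rewrite -dE; pose A := [set i | x i == a]; pose g i := y i - y i0.
have inj_g : {in A &, injective g}.
  move=> i j; rewrite !inE => /eqP xi /eqP xj /addIr yij.
  apply/injP/val_inj; rewrite [LHS]surjective_pairing [RHS]surjective_pairing.
  by congr (_, _); rewrite // -/(x i) -/(x j) xi xj.
have g_B i : i \in A -> g i \in trace_kernel F q.
  rewrite inE => /eqP xi; apply: trace_kernelB => //.
  by rewrite !curve_pointE -/(x i) -/(x i0) xi (eqP xi0).
have gA_B : g @: A \subset trace_kernel F q.
  by apply/subsetP => _ /imsetP[i Ai ->]; apply: g_B.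
(* Only the conjugates that correspond to points above a are kept; the other factors are dropped. *)
rewrite (big_setID (g @: A)) /= (setIidPr gA_B) dvdp_mulr // big_imset //=.
have -> : E a = (\sum_(i in A) e i)%N by apply: eq_bigl => i; rewrite inE.
rewrite -prodrXr.
elim/big_ind2: _ => [||i Ai]; [exact: dvdpp | by move=> *; apply: dvdp_mul | ].
have xi : x i = a by move: Ai; rewrite inE => /eqP.
rewrite -{1}xi; apply: mult_ge_expand => //.
- by rewrite hornerD hornerC -/(x i) xi Ya /g addrC subrK.
rewrite -/(x i) xi.
have -> : (herm_poly F q).[Y + (g i)%:P] = (herm_poly F q).[Y].
  rewrite -{2}(shift_herm q_pchar (g_B i Ai)) horner_comp.
  by congr _.[_]; rewrite hornerD hornerX hornerC.
apply: dvdp_trans dvd_Y; rewrite dvdp_exp2l // /E (bigD1 i) ?xi //=.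
exact: leq_addr.
Qed.
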